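(* Let $G$ be a disconnected finite simple graph. Then $G$ is near-factor-critical if and only if one of the following holds. (1) All components of $G$ are even and each of them has a $1$-factor. (2) $G$ has exactly two components $H_1$ and $H_2$, and each of them is factor-critical.
   Context: All graphs are finite and simple, with vertex set $V(G)$ and edge set $E(G)$. A matching $M$ of $G$ is a subset of $E(G)$ (possibly empty) such that no two edges in $M$ share a common endpoint. A matching $M$ saturates a vertex $v$ if $v$ is an endpoint of some edge in $M$. A $1$-factor (perfect matching) of $G$ is a matching that saturates every vertex of $G$. A near-factor of $G$ is a matching that saturates all vertices of $G$ except one (exactly one vertex is unsaturated). For a vertex $v$, $G - v$ denotes the graph obtained from $G$ by deleting $v$. A graph $G$ is factor-critical if $G - v$ has a $1$-factor for every $v \in V(G)$. A graph $G$ is near-factor-critical if $G - v$ has a near-factor for every $v \in V(G)$. A component of a graph is a maximal connected subgraph; it is even if it has an even number of vertices. *)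

(* Defs.v *)
From mathcomp Require Import all_boot.

Set Implicit Arguments.
Unset Strict Implicit.
Unset Printing Implicit Defensive.

(* The vertex set is an arbitrary finite set inside an ambient finite type T,
   so that subgraphs, components and G - v are again graphs over T. *)
Record graph (T : finType) := Graph {
  vset : {set T};
  eset : {set {set T}};
  esetP : [forall e in eset, (e \subset vset) && (#|e| == 2)]
}.

Definition adj (T : finType) (G : graph T) : rel T :=
  [rel x y | [set x; y] \in eset G].

Definition subgraph (T : finType) (H G : graph T) : bool :=
  (vset H \subset vset G) && (eset H \subset eset G).

(* The null graph is not connected, so that components are nonempty. *)
Definition connected (T : finType) (G : graph T) : Prop :=
  vset G != set0 /\
  {in vset G &, forall x y, connect (adj G) x y}.

Definition disconnected (T : finType) (G : graph T) : Prop := ~ connected G.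

Definition component (T : finType) (G H : graph T) : Prop :=
  [/\ subgraph H G, connected H &
      forall K : graph T,
        subgraph K G -> connected K -> subgraph H K -> K = H].

Lemma del_vertex_subproof (T : finType) (G : graph T) (v : T) :
  [forall e in [set e in eset G | v \notin e],
     (e \subset vset G :\ v) && (#|e| == 2)].
Proof.
apply/forall_inP => e; rewrite inE => /andP[eG ve].
have /andP[eV ->] := forall_inP (esetP G) e eG.
by rewrite subsetD1 eV ve.
Qed.

Definition del_vertex (T : finType) (G : graph T) (v : T) : graph T :=
  Graph (del_vertex_subproof G v).

Definition matching (T : finType) (G : graph T) (M : {set {set T}}) : bool :=
  (M \subset eset G) && trivIset M.

Definition saturates (T : finType) (M : {set {set T}}) (v : T) : bool :=
  [exists e in M, v \in e].

Definition one_factor (T : finType) (G : graph T) (M : {set {set T}}) : bool :=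
  matching G M && [forall v in vset G, saturates M v].

Definition near_factor (T : finType) (G : graph T) (M : {set {set T}}) : bool :=
  matching G M && (#|[set v in vset G | ~~ saturates M v]| == 1).

Definition has_one_factor (T : finType) (G : graph T) : Prop :=
  exists M : {set {set T}}, one_factor G M.

Definition has_near_factor (T : finType) (G : graph T) : Prop :=
  exists M : {set {set T}}, near_factor G M.

Definition factor_critical (T : finType) (G : graph T) : Prop :=
  {in vset G, forall v, has_one_factor (del_vertex G v)}.

Definition near_factor_critical (T : finType) (G : graph T) : Prop :=
  {in vset G, forall v, has_near_factor (del_vertex G v)}.

(* Main.v *)
Require Import Defs.
From mathcomp Require Import all_boot.

Set Implicit Arguments.
Unset Strict Implicit.
Unset Printing Implicit Defensive.

(* Edges never leave a component, so a matching of G restricts to a matching of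
   each component, and the set of vertices saturated inside a component has even
   size.  If G - v has a near-factor missing u, then every component has an even
   number of vertices other than u and v, and these are perfectly matched.  If
   all components are even, u lies in the component of v and every other
   component is perfectly matched.  If C is an odd component and v is in C, then
   u lies in a second odd component and C - v is perfectly matched; no vertex w
   lies in a third component, for deleting w would leave one of the two odd
   components without u and w. *)

Section Graph.

Variable T : finType.
Implicit Types (G H K : graph T) (M : {set {set T}}) (A B : {set T}).

(** * Edges and adjacency *)

Lemma graph_eq G H : vset G = vset H -> eset G = eset H -> G = H.
Proof.
case: G H => [V E p] [V' E' p'] /= eV eE; subst V' E'.
by rewrite (bool_irrelevance p p').
Qed.

Lemma edge_sub G (e : {set T}) : e \in eset G -> e \subset vset G.
Proof. by move=> eG; case/andP: (forall_inP (esetP G) e eG). Qed.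

Lemma edge_card G (e : {set T}) : e \in eset G -> #|e| = 2.
Proof. by move=> eG; case/andP: (forall_inP (esetP G) e eG) => _ /eqP. Qed.

Lemma adj_sym G : symmetric (adj G).
Proof. by move=> x y; rewrite /adj /= setUC. Qed.

Lemma adj_vset G x y : adj G x y -> y \in vset G.
Proof. by move=> /edge_sub /subsetP; apply; rewrite set22. Qed.

Lemma connect_adj_sym G : connect_sym (adj G).
Proof. exact/sym_connect_sym/adj_sym. Qed.

(** * Induced subgraphs and components *)

Lemma induced_subproof G A :
  [forall e in [set e in eset G | e \subset A],
     (e \subset A :&: vset G) && (#|e| == 2)].
Proof.
apply/forall_inP => e; rewrite inE => /andP[eG eA].
by rewrite subsetI eA (edge_sub eG) (edge_card eG).
Qed.

Definition induced G A : graph T := Graph (induced_subproof G A).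

(** A component is handled through its vertex set, a reachability class, so that matchings can stay
    in [G]. For [x] outside [vset G] the set is empty. *)
Definition comp G x : {set T} := [set y in vset G | connect (adj G) x y].

Lemma comp_sub G x : comp G x \subset vset G.
Proof. by apply/subsetP => y; rewrite inE => /andP[]. Qed.

Lemma comp_refl G x : x \in vset G -> x \in comp G x.
Proof. by rewrite inE => ->; rewrite connect0. Qed.

Lemma comp_eq G x y : y \in comp G x -> comp G y = comp G x.
Proof.
rewrite inE => /andP[_ xy]; apply/setP => z; rewrite !inE.
by rewrite (same_connect (connect_adj_sym G) xy).
Qed.

Lemma comp_disjoint G x y : x \in vset G -> x \notin comp G y ->
  [disjoint comp G x & comp G y].
Proof.
move=> xV; apply: contraR => /pred0Pn[z /andP[/= zx zy]].
by rewrite -(comp_eq zy) (comp_eq zx) comp_refl.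
Qed.

Lemma vset_two_comp G x y :
    {in vset G, forall w, w \in comp G x \/ w \in comp G y} ->
  vset G = comp G x :|: comp G y.
Proof.
move=> cov; apply/eqP; rewrite eqEsubset; apply/andP; split.
  by apply/subsetP => w wV; apply/setUP/cov.
by rewrite subUset !comp_sub.
Qed.

Lemma comp_adj G x y z : y \in comp G x -> adj G y z -> z \in comp G x.
Proof.
rewrite !inE => /andP[_ xy] yz.
by rewrite (adj_vset yz) (connect_trans xy (connect1 yz)).
Qed.

Lemma edge_comp G x y (e : {set T}) :
  e \in eset G -> y \in e -> y \in comp G x -> e \subset comp G x.
Proof.
move=> eG ye yC; apply/subsetP => z ze; have [->//|zy] := eqVneq z y.
apply: comp_adj yC _; rewrite /adj /=.
(* A two-element subset of the two-element edge [e] is all of [e]. *)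
suff /eqP -> : [set y; z] == e by [].
by rewrite eqEcard subUset !sub1set ye ze cards2 eq_sym zy (edge_card eG).
Qed.

Lemma vset_induced_comp G x : vset (induced G (comp G x)) = comp G x.
Proof. exact/setIidPl/comp_sub. Qed.

(** A path of [G] starting in the class never leaves it, so each of its edges survives in the
    induced subgraph. *)
Lemma connected_induced_comp G x :
  x \in vset G -> connected (induced G (comp G x)).
Proof.
move=> xV; rewrite /connected vset_induced_comp; split.
  by apply/set0Pn; exists x; apply: comp_refl.
set K := induced _ _ => y z yC zC.
have : connect (adj G) y z.
  by move: zC; rewrite -(comp_eq yC) inE => /andP[].
case/connectP => p; elim: p y yC => [|w p IH] y yC /= pth defz.
  by rewrite defz connect0.
case/andP: pth => yw pth; have wC := comp_adj yC yw.
apply: connect_trans (IH w wC pth defz); apply: connect1.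
by rewrite /adj /= inE [_ \in _]yw subUset !sub1set yC.
Qed.

Lemma subgraph_connected_comp G H x :
  subgraph H G -> connected H -> x \in vset H -> vset H \subset comp G x.
Proof.
case/andP => sV sE [_ cH] xH; apply/subsetP => y yH.
rewrite inE (subsetP sV) //=; apply: connect_sub (cH x y xH yH) => a b ab.
by apply/connect1/(subsetP sE).
Qed.

Lemma subgraph_induced G H A :
  subgraph H G -> vset H \subset A -> subgraph H (induced G A).
Proof.
case/andP => sV sE sA; rewrite /subgraph /= subsetI sA sV /=.
apply/subsetP => e eH; rewrite inE (subsetP sE) //=.
exact: subset_trans (edge_sub eH) sA.
Qed.

Lemma induced_subgraph G A : subgraph (induced G A) G.
Proof.
by rewrite /subgraph subsetIr /=; apply/subsetP => e; rewrite inE => /andP[].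
Qed.

(** A connected subgraph lies inside the subgraph induced on the class of any of its vertices, and
    that subgraph is itself connected; maximality then forces equality in both directions. *)
Lemma componentP G H :
  component G H <-> exists2 x, x \in vset G & H = induced G (comp G x).
Proof.
split=> [[sH cH maxH] | [x xV ->]].
  have [/set0Pn[x xH] _] := cH.
  have xV : x \in vset G by case/andP: sH => /subsetP sV _; apply: sV.
  exists x => //; apply/esym/maxH; first exact: induced_subgraph.
    exact: connected_induced_comp.
  exact/subgraph_induced/subgraph_connected_comp.
split; [exact: induced_subgraph | exact: connected_induced_comp |].
move=> K sK cK /andP[sCV sCE].
have xK : x \in vset K by apply: (subsetP sCV); rewrite vset_induced_comp comp_refl.
have /andP[sVC sEC] := subgraph_induced sK (subgraph_connected_comp sK cK xK).
by apply: graph_eq; apply/eqP; rewrite eqEsubset ?sCV ?sCE ?sVC ?sEC.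
Qed.

(** * Vertex sets covered exactly by a matching *)

Lemma setD1_id A x : x \notin A -> A :\ x = A.
Proof. by move=> xA; apply/setDidPl; rewrite disjoint_sym disjoints1. Qed.

(** Amounts to a perfect matching of the subgraph induced on [A]: exact covering forces every edge
    of [M] to lie inside [A]. *)
Definition matchable G A : Prop := exists2 M, matching G M & cover M = A.

Lemma saturatesE M x : saturates M x = (x \in cover M).
Proof. by apply/exists_inP/bigcupP. Qed.

Lemma matchable_even G A : matchable G A -> ~~ odd #|A|.
Proof.
case=> M /andP[sM tM] <-; move: tM => /eqP <-.
rewrite (eq_bigr (fun=> 2)); first by rewrite sum_nat_const muln2 odd_double.
by move=> e /(subsetP sM) /edge_card.
Qed.

(** An edge with one end in the class lies inside it, so the edges of [M] inside the class still
    cover its part of [A]. *)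
Lemma matchable_comp G A x : matchable G A -> matchable G (A :&: comp G x).
Proof.
case=> M /andP[sM tM] <-; exists [set e in M | e \subset comp G x].
  have sMM : [set e in M | e \subset comp G x] \subset M.
    by apply/subsetP => e; rewrite inE => /andP[].
  by rewrite /matching (subset_trans sMM sM) (trivIsetS sMM tM).
apply/setP => y; rewrite inE; apply/bigcupP/andP.
  case=> e; rewrite inE => /andP[eM eC] ye.
  by split; [apply/bigcupP; exists e | apply: (subsetP eC)].
case=> /bigcupP[e eM ye] yC; exists e => //; rewrite inE eM /=.
exact: edge_comp (subsetP sM _ eM) ye yC.
Qed.

Lemma matchableU G A B :
  [disjoint A & B] -> matchable G A -> matchable G B -> matchable G (A :|: B).
Proof.
move=> dAB [M /andP[sM tM] cM] [N /andP[sN tN] cN].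
exists (M :|: N); last by rewrite /cover bigcup_setU -!/(cover _) cM cN.
rewrite /matching subUset sM sN /=; apply/trivIsetP => e f.
have dMN e' f' : e' \in M -> f' \in N -> [disjoint e' & f'].
  move=> eM fN; apply: disjointWl (disjointWr _ dAB).
    by rewrite -cM; apply: bigcup_sup eM.
  by rewrite -cN; apply: bigcup_sup fN.
rewrite !inE => /orP[eM|eN] /orP[fM|fN].
- exact: (trivIsetP tM).
- by move=> _; apply: dMN.
- by move=> _; rewrite disjoint_sym; apply: dMN.
- exact: (trivIsetP tN).
Qed.

(** Take for [u] the partner of [v] and drop their common edge. *)
Lemma matchable_del_edge G A v : matchable G A -> v \in A ->
  exists2 u, u \in A :\ v & matchable G (A :\ v :\ u).
Proof.
case=> M /andP[sM tM] <- /bigcupP[e eM ve].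
have /cards1P[u defu] : #|e :\ v| == 1.
  by have := edge_card (subsetP sM e eM); rewrite (cardsD1 v) ve add1n => -[->].
have ue : u \in e :\ v by rewrite defu set11.
exists u.
  move: ue; rewrite !inE => /andP[-> ue] /=.
  by apply/bigcupP; exists e.
exists (M :\ e); last by rewrite coverD1 // setDDl -defu setD1K.
have sMe : M :\ e \subset M by apply: subsetDl.
by rewrite /matching (subset_trans sMe sM) (trivIsetS sMe tM).
Qed.

(** Strong induction on the size of [A], peeling off one component at a time. Components are
    disjoint, so the rest is again a union of components; this is why [A] is not fixed to
    [vset G]. *)
Lemma matchable_closed G A : A \subset vset G ->
    {in vset G, forall x, matchable G (comp G x)} ->
    {in A, forall x, comp G x \subset A} -> matchable G A.
Proof.
have [n] := ubnP #|A|; elim: n A => // n IH A; rewrite ltnS => leA sA mC clA.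
have [->|[x xA]] := set_0Vmem A.
  exists set0; last by rewrite /cover big_set0.
  by rewrite /matching sub0set; apply/trivIsetP => e f; rewrite inE.
have xV := subsetP sA x xA.
rewrite -(setID A (comp G x)) (setIidPr (clA x xA)).
apply: matchableU (mC x xV) (IH _ _ _ mC _).
- by rewrite disjoint_sym disjoints_subset setDE subsetIr.
- apply: leq_trans leA; apply/proper_card/properP; split; first exact: subsetDl.
  by exists x; rewrite // inE comp_refl.
- exact: subset_trans (subsetDl _ _) sA.
- move=> y; rewrite inE => /andP[yC yA]; rewrite subsetD clA //=.
  by rewrite comp_disjoint // (subsetP sA).
Qed.

(** * Factors of subgraphs as matchable sets of [G] *)

Lemma one_factorP K : has_one_factor K <-> matchable K (vset K).
Proof.
split=> [[M /andP[mM /forall_inP sat]] | [M mM cM]]; exists M => //.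
  apply/eqP; rewrite eqEsubset; apply/andP; split; last first.
    by apply/subsetP => x /sat; rewrite saturatesE.
  apply/bigcupsP => e eM; case/andP: mM => /subsetP sM _.
  exact/edge_sub/sM.
by rewrite /one_factor mM; apply/forall_inP => x; rewrite saturatesE cM.
Qed.

Lemma matchable_sub G K A :
  subgraph K G -> {in eset G, forall e : {set T}, e \subset A -> e \in eset K} ->
  matchable K A <-> matchable G A.
Proof.
case/andP=> _ sE sA; split=> -[M /andP[sM tM] cM]; exists M => //.
  by rewrite /matching (subset_trans sM sE).
rewrite /matching tM andbT; apply/subsetP => e eM.
by apply: sA; [apply: (subsetP sM) | rewrite -cM; apply: bigcup_sup eM].
Qed.

Lemma matchable_del_vertex G v A :
  v \notin A -> matchable (del_vertex G v) A <-> matchable G A.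
Proof.
move=> vA; apply: matchable_sub.
  rewrite /subgraph subsetDl /=.
  by apply/subsetP => e; rewrite inE => /andP[].
move=> e eG eA; rewrite inE eG /=.
by apply: contra vA; apply: (subsetP eA).
Qed.

Lemma matchable_induced G A B :
  A \subset B -> matchable (induced G B) A <-> matchable G A.
Proof.
move=> sAB; apply: matchable_sub; first exact: induced_subgraph.
by move=> e eG eA; rewrite inE eG (subset_trans eA).
Qed.

Lemma one_factor_comp G x :
  has_one_factor (induced G (comp G x)) <-> matchable G (comp G x).
Proof.
apply: iff_trans (one_factorP _) _.
by rewrite vset_induced_comp; apply: matchable_induced.
Qed.

Lemma factor_critical_comp G x :
  factor_critical (induced G (comp G x)) <->
  {in comp G x, forall v, matchable G (comp G x :\ v)}.
Proof.
rewrite /factor_critical vset_induced_comp.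
have eqv v : has_one_factor (del_vertex (induced G (comp G x)) v) <->
             matchable G (comp G x :\ v).
  apply: iff_trans (one_factorP _) _.
  rewrite [vset _]/(vset (induced G (comp G x)) :\ v) vset_induced_comp.
  apply: iff_trans (matchable_del_vertex _ _) _; first by rewrite setD11.
  exact/matchable_induced/subsetDl.
by split=> fc v vC; apply/eqv/fc.
Qed.

Lemma near_factor_del_vertexP G v :
  has_near_factor (del_vertex G v) <->
  exists2 u, u \in vset G :\ v & matchable G (vset G :\ v :\ u).
Proof.
split=> [[M /andP[mM /cards1P[u defu]]] | [u uV]].
  have /setIdP[uV _] : u \in [set x in vset (del_vertex G v) | ~~ saturates M x].
    by rewrite defu set11.
  exists u => //; apply/(@matchable_del_vertex G v).
    by rewrite !inE eqxx andbF.
  exists M => //; apply/setP => x; rewrite in_setD1.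
  move/setP/(_ x): defu; rewrite in_set in_set1 saturatesE => <-.
  (* By [defu], [x] differs from [u] unless it is an unsaturated vertex of [G - v]. A covered [x] is
     a vertex because it lies on an edge of [G - v]. *)
  rewrite negb_and negbK; case: (boolP (x \in cover M)) => [xM|_].
    rewrite orbT /=; apply/esym; case/bigcupP: xM => e eM.
    by have /andP[/subsetP sM _] := mM; apply/subsetP; have /edge_sub := sM e eM.
  by rewrite orbF /=; case: (x \in _).
move/(@matchable_del_vertex G v); case=> [|M mM cM].
  by rewrite !inE eqxx andbF.
exists M; rewrite /near_factor mM; apply/cards1P; exists u; apply/setP => x.
rewrite in_set in_set1 saturatesE cM in_setD1 negb_and negbK /=.
by have [->|_] := eqVneq x u; [rewrite uV | case: (x \in _)].
Qed.

(** * Parity of the components of a near-factor-critical graph *)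

Lemma near_factor_criticalP G :
  near_factor_critical G <->
  {in vset G, forall v, exists2 u, u \in vset G :\ v &
     matchable G (vset G :\ v :\ u)}.
Proof. by split=> nf v vV; apply/near_factor_del_vertexP/nf. Qed.

Lemma near_factor_comp G v u w :
  matchable G (vset G :\ v :\ u) -> matchable G (comp G w :\ v :\ u).
Proof.
move/(matchable_comp w).
by rewrite !setIDAC (setIidPr (comp_sub _ _)).
Qed.

(** If the missed vertex [u] shared the component of [v], an odd number of vertices would be
    perfectly matched there. *)
Lemma odd_comp_near_factor G v : near_factor_critical G ->
    v \in vset G -> odd #|comp G v| ->
  exists2 u, u \in vset G & [/\ u \notin comp G v, odd #|comp G u| &
    matchable G (comp G v :\ v)].
Proof.
move=> /near_factor_criticalP nf vV oddC.
have [u /setD1P[uv uV] mu] := nf v vV; exists u => //.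
have uC : u \notin comp G v.
  apply/negP => uC; have := matchable_even (near_factor_comp v mu).
  move: oddC; rewrite (cardsD1 v) comp_refl // (cardsD1 u (_ :\ _)) in_setD1 uv uC.
  by rewrite !oddD /= negbK => ->.
have vC : v \notin comp G u.
  by apply: contra uC => /comp_eq ->; apply: comp_refl.
split=> //.
  have := matchable_even (near_factor_comp u mu).
  by rewrite (setD1_id vC) (cardsD1 u (comp G u)) comp_refl.
have := near_factor_comp v mu; rewrite setD1_id //.
by rewrite in_setD1 (negPf uC) andbF.
Qed.

(** Delete [y], which lies elsewhere: by parity the missed vertex is not in the even component,
    which is therefore matched whole. *)
Lemma all_comp_even_matchable G x y : near_factor_critical G ->
    x \in vset G -> y \in vset G -> y \notin comp G x ->
  ~~ odd #|comp G x| -> matchable G (comp G x).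
Proof.
move=> /near_factor_criticalP nf xV yV yC evC.
have [u /setD1P[uy uV] mu] := nf y yV.
have := near_factor_comp x mu; rewrite (setD1_id yC).
have [uC /matchable_even|uC] := boolP (u \in comp G x); last by rewrite setD1_id.
by move: evC; rewrite (cardsD1 u) uC oddD /= negbK => ->.
Qed.

Lemma disconnected_comp G x : disconnected G -> x \in vset G ->
  exists2 y, y \in vset G & y \notin comp G x.
Proof.
move=> dG xV; apply/subsetPn/negP => sVC; apply: dG; split.
  by apply/set0Pn; exists x.
move=> y z yV zV; have := subsetP sVC z zV.
by rewrite -(comp_eq (subsetP sVC y yV)) inE => /andP[].
Qed.

(** With a vertex [w] outside both classes deleted, each odd class would have to contain the single
    missed vertex [t]. *)
Lemma near_factor_critical_odd_cover G x u : near_factor_critical G ->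
    x \in vset G -> u \in vset G -> u \notin comp G x ->
    odd #|comp G x| -> odd #|comp G u| ->
  vset G = comp G x :|: comp G u.
Proof.
move=> nf xV uV uC ox ou; apply: vset_two_comp => w wV; apply/orP/negPn; rewrite negb_or.
apply/negP => /andP[wx wu].
have [t /setD1P[tw tV] mt] := (near_factor_criticalP G).1 nf w wV.
have tC y : odd #|comp G y| -> w \notin comp G y -> t \in comp G y.
  move=> oy wy; apply/negPn/negP => ty.
  have := matchable_even (near_factor_comp y mt).
  by rewrite !setD1_id ?oy.
by case/negP: uC; rewrite -(comp_eq (tC x ox wx)) (comp_eq (tC u ou wu)) comp_refl.
Qed.

Lemma matchable_two_comp G x y v :
    v \in comp G x -> y \notin comp G x -> y \in vset G ->
    {in vset G, forall w, w \in comp G x \/ w \in comp G y} ->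
    {in comp G x, forall w, matchable G (comp G x :\ w)} ->
    {in comp G y, forall w, matchable G (comp G y :\ w)} ->
  exists2 u, u \in vset G :\ v & matchable G (vset G :\ v :\ u).
Proof.
move=> vC yx yV cov fcx fcy; have vy : v != y by apply: contraNneq yx => <-.
have dyx := comp_disjoint yV yx.
(* Any vertex of the other component could be the missed one; its representative [y] is at hand. *)
exists y; first by rewrite in_setD1 eq_sym vy.
suff -> : vset G :\ v :\ y = comp G x :\ v :|: comp G y :\ y.
  apply: matchableU (fcx v vC) (fcy y (comp_refl yV)).
  rewrite disjoint_sym; apply: disjointWl (subsetDl _ _) _.
  exact: disjointWr (subsetDl _ _) dyx.
rewrite (vset_two_comp cov) !setDUl (setD1_id (x := v) (A := comp G y)).
  by rewrite (setD1_id (x := y)) // in_setD1 (negPf yx) andbF.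
by rewrite (disjointFl dyx vC).
Qed.

End Graph.

Theorem theorem3 (T : finType) (G : graph T) (hG : disconnected G) :
  near_factor_critical G <->
  (forall H : graph T, component G H ->
     ~~ odd #|vset H| /\ has_one_factor H) \/
  (exists H1 H2 : graph T,
     [/\ H1 <> H2,
         forall H : graph T, component G H <-> H = H1 \/ H = H2,
         factor_critical H1 & factor_critical H2]).
Proof.
split=> [nf|].
  have [/exists_inP[x xV ox]|allev] := boolP [exists x in vset G, odd #|comp G x|].
    right; have [u uV [ux ou _]] := odd_comp_near_factor nf xV ox.
    exists (induced G (comp G x)), (induced G (comp G u)).
    (* The parity argument applies at every vertex [v] of an odd component, since [v] has the same
       class as [y]. *)
    have fc y : odd #|comp G y| -> factor_critical (induced G (comp G y)).
      move=> oy; apply/factor_critical_comp => v vC.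
      have vV := subsetP (comp_sub G y) v vC.
      have [|t _ [_ _]] := odd_comp_near_factor nf vV; first by rewrite (comp_eq vC).
      by rewrite (comp_eq vC).
    split; [|move=> H|exact: fc|exact: fc].
      move/(congr1 (@vset T)); rewrite !vset_induced_comp => eqC.
      by case/negP: ux; rewrite eqC comp_refl.
    apply: iff_trans (componentP _ _) _; split=> [[w wV ->]|[]->]; [|by exists x|by exists u].
    move: wV; rewrite (near_factor_critical_odd_cover nf xV uV ux ox ou).
    by case/setUP => /comp_eq ->; [left | right].
  left=> H /componentP[x xV ->]; rewrite vset_induced_comp.
  have evx : ~~ odd #|comp G x|.
    by apply: contra allev => ox; apply/exists_inP; exists x.
  have [y yV yC] := disconnected_comp hG xV.
  by split=> //; apply/one_factor_comp; apply: all_comp_even_matchable yV yC evx.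
case=> [pm | [H1 [H2 [neqH compH fc1 fc2]]]]; apply/near_factor_criticalP => v vV.
  (* The matchings of the components join to a 1-factor of [G], and the missed vertex is the partner
     of [v]. *)
  apply: matchable_del_edge vV; apply: matchable_closed => // x xV.
    by apply/one_factor_comp; apply: (pm _ _).2; apply/componentP; exists x.
  exact: comp_sub.
have [x xV defH1] := (componentP G H1).1 ((compH H1).2 (or_introl erefl)).
have [y yV defH2] := (componentP G H2).1 ((compH H2).2 (or_intror erefl)).
subst H1 H2; move/factor_critical_comp in fc1; move/factor_critical_comp in fc2.
(* Equal classes would induce equal graphs, against [neqH]. *)
have yx : y \notin comp G x by apply/negP => /comp_eq eqC; rewrite eqC in neqH.
have cover_xy w : w \in vset G -> w \in comp G x \/ w \in comp G y.
  move=> wV; have wC := comp_refl wV.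
  have compw : component G (induced G (comp G w)) by apply/componentP; exists w.
  by case: ((compH _).1 compw) => /(congr1 (@vset T));
    rewrite !vset_induced_comp => <-; [left | right].
case: (cover_xy v vV) => vC.
  exact: matchable_two_comp vC yx yV cover_xy fc1 fc2.
have xy : x \notin comp G y.
  by apply: contra yx => /comp_eq ->; apply: comp_refl.
apply: matchable_two_comp vC xy xV _ fc2 fc1.
by move=> w /cover_xy [] ?; [right | left].
Qed.
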